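(* Let $T\in\mathbb N$ be a time horizon, let $A\ge2$ be the number of arms, let $c(1),\dots,c(A)\ge0$ be arm-dependent query costs, let $B\ge0$, and let $\pi$ be a bandit strategy such that for every bandit instance $\mathbb E[B^q(T)]\le B$. Then there exists a bandit instance for which $$\mathbb E[\mathrm{Reg}(T)]\ge\frac1{140}\min\left\{T\sqrt{\frac{\sum_{a=1}^Ac(a)}{B(1+\log A)}},\,T\right\}.$$
   Context: Bandit model with reward queries. A bandit instance is a tuple $(\nu_a)_{a=1}^A$ of probability distributions on $[0,1]$ with means $r(a)$. At each round $t$ the agent chooses an arm $a_t$ and $q_t\in\{0,1\}$; a reward $R_t\sim\nu_{a_t}$ is generated independently of other rounds, and the agent observes only $Y_t=R_t\cdot q_t$. A bandit strategy $\pi$ chooses $(a_{t+1},q_{t+1})$ as a measurable function of $I_t=(U_0,Y_1,U_1,\dots,Y_t,U_t)$, where $U_0,U_1,\dots$ are i.i.d. uniform on $[0,1]$ (internal randomization). $B^q(T)=\sum_{t=1}^Tc(a_t)\mathbf 1\{q_t=1\}$ is the total query cost and $\mathrm{Reg}(T)=\sum_{t=1}^T(\max_ar(a)-r(a_t))$. Conventions: $x/0=+\infty$ for $x>0$ and $0/0=0$. *)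

(* Defs.v *)
From HB Require Import structures.
From mathcomp Require Import all_boot all_order all_algebra.
From mathcomp Require Import all_classical all_reals all_analysis.
From mathcomp Require Import zify measurable_realfun measurable_function.
Import Order.TTheory GRing.Theory Num.Theory.
Import numFieldNormedType.Exports.

Set Implicit Arguments.
Unset Strict Implicit.
Unset Printing Implicit Defensive.

Local Open Scope classical_set_scope.
Local Open Scope ring_scope.

Record bandit_instance (R : realType) (A : nat) := BanditInstance {
  reward_law :> 'I_A -> probability (measurableTypeR R) R;
  reward_law01 : forall a, reward_law a `[0, 1]%classic = 1%E }.

Definition mean (R : realType) (A : nat) (nu : bandit_instance R A) (a : 'I_A)
    : R :=
  \int[nu a]_x x.

(* Means are nonnegative, so [0] is neutral as soon as [0 < A]. *)
Definition best_mean (R : realType) (A : nat) (nu : bandit_instance R A) : R :=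
  \big[Num.max/0]_(a < A) mean nu a.

(* Tuples of values of (U_i) and of (Y_i) (or (R_i)), with their product
   sigma-algebra; [trace R t.+1 t] is the range of I_t. *)
Notation trace R m n :=
  (m.-tuple (measurableTypeR R) * n.-tuple (measurableTypeR R))%type.

(* [decide pi t] is the decision (a_(t+1), q_(t+1)) as a function of I_t.
   'I_A carries no measurable structure in the library; it is embedded in nat,
   whose sigma-algebra is discrete. *)
Record strategy (R : realType) (A : nat) := Strategy {
  decide : forall t : nat, trace R t.+1 t -> 'I_A * bool;
  measurable_decide_arm : forall t,
    measurable_fun [set: trace R t.+1 t] (fun h => nat_of_ord (decide h).1);
  measurable_decide_query : forall t,
    measurable_fun [set: trace R t.+1 t] (fun h => (decide h).2) }.

(* (X_m, ..., X_(m+n-1)) *)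
Definition window (R : realType) (Omega : Type)
    (X : nat -> Omega -> measurableTypeR R) (m n : nat) (w : Omega)
    : n.-tuple (measurableTypeR R) :=
  [tuple X (m + i)%N w | i < n].

(* A probability space carrying [T] rounds of interaction between [pi] and
   [nu]: rounds are numbered from 1, and only the values at index 0 <= t <= T of
   [seed] (the variables U_t) and 1 <= t <= T of [reward], [arm], [query]
   (the variables R_t, a_t, q_t) are meaningful.
   - [seed_law]: U_t is uniform on [0, 1] and independent of
     (U_0, ..., U_(t-1), R_1, ..., R_t);
   - [reward_cond_law]: conditionally on (U_0, ..., U_t, R_1, ..., R_t),
     which determines a_(t+1), the reward R_(t+1) has law nu_(a_(t+1)). *)
Record interaction (R : realType) (A T : nat) (pi : strategy R A)
    (nu : bandit_instance R A) := Interaction {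
  sample_display : measure_display;
  sample_space : measurableType sample_display;
  prob : probability sample_space R;
  seed : nat -> {RV prob >-> measurableTypeR R};
  reward : nat -> {RV prob >-> measurableTypeR R};
  arm : nat -> sample_space -> 'I_A;
  query : nat -> sample_space -> bool;
  observation := fun t w => reward t w * (query t w)%:R;
  decision_rule : forall t w, (t < T)%N ->
    (arm t.+1 w, query t.+1 w) =
      decide pi (window seed 0 t.+1 w, window observation 1 t w);
  seed_law : forall t, (t <= T)%N ->
    forall (C : set (trace R t t)) (D : set (measurableTypeR R)),
    measurable C -> measurable D ->
    prob [set w | C (window seed 0 t w, window reward 1 t w) /\ D (seed t w)] =
      (prob [set w | C (window seed 0 t w, window reward 1 t w)] *
         uniform_prob (@ltr01 R) D)%E;
  reward_cond_law : forall t, (t < T)%N ->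
    forall (C : set (trace R t.+1 t)) (D : set (measurableTypeR R)),
    measurable C -> measurable D ->
    prob [set w | C (window seed 0 t.+1 w, window reward 1 t w) /\
                  D (reward t.+1 w)] =
      (\int[prob]_(w in [set w | C (window seed 0 t.+1 w,
                                    window reward 1 t w)])
         nu (arm t.+1 w) D)%E }.

Arguments arm {R A T pi nu} i t w.
Arguments query {R A T pi nu} i t w.
Arguments observation {R A T pi nu} i t w.

Definition query_cost (R : realType) (A T : nat) (pi : strategy R A)
    (nu : bandit_instance R A) (c : 'I_A -> R) (M : interaction T pi nu)
    (w : sample_space M) : R :=
  \sum_(1 <= t < T.+1) c (arm M t w) * (query M t w)%:R.

Definition regret (R : realType) (A T : nat) (pi : strategy R A)
    (nu : bandit_instance R A) (M : interaction T pi nu) (w : sample_space M) : R :=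
  \sum_(1 <= t < T.+1) (best_mean nu - mean nu (arm M t w)).

Arguments query_cost {R A T pi nu} c M w.
Arguments regret {R A T pi nu} M w.

(* Non-vacuity of [interaction]: from [T] rounds on [W], one more round is built
   on [W * R * R], the reward having law nu_(a w) given w in [W] and the seed
   being uniform and independent of the rest. *)
Module InteractionExists.

Section extension.
Context (R : realType) (A : nat) d (W : measurableType d) (P : probability W R).
Local Notation mR := (measurableTypeR R).
Variables (nu : nat -> probability mR R) (a : W -> nat).
Hypothesis ma : measurable_fun setT a.
Hypothesis aA : forall w, (a w < A)%N.

Definition slice n : set (W * mR) := [set z | a z.1 = n].
Lemma measurable_arm_eq n : measurable [set w | a w = n].
Proof. by rewrite -[X in measurable X]setTI; exact: (ma measurableT (Y:=[set n])). Qed.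
Lemma measurable_slice n : measurable (slice n).
Proof.
have -> : slice n = [set w | a w = n] `*` setT by apply/seteqP; split => z //= [].
exact: measurableX (measurable_arm_eq n) measurableT.
Qed.
Definition reward_ext : {measure set (W * mR) -> \bar R} := msum (fun n => mrestr (P \x nu n)%E (measurable_slice n)) A.

Lemma reward_extE C D : measurable C -> measurable D ->
  reward_ext (C `*` D) = (\int[P]_(w in C) nu (a w) D)%E.
Proof.
move=> mC mD; rewrite /reward_ext /= /msum /=.
transitivity (\sum_(n < A) P (C `&` [set w | a w = n]) * nu n D)%E.
  apply: eq_bigr => n _; rewrite /mrestr.
  have -> : (C `*` D) `&` slice n = (C `&` [set w | a w = n]) `*` D.
    by rewrite /slice; apply/seteqP; split => z /=; tauto.
  apply: product_measure1E => //; apply: measurableI => //; exact: measurable_arm_eq.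
transitivity (\int[P]_(w in C) (\sum_(n <- index_enum 'I_A) nu n D * (\1_[set w | a w = n] w)%:E))%E.
  rewrite ge0_integral_sum//=.
  - apply: eq_bigr => n _; rewrite ge0_integralZl//=.
    + by rewrite integral_indic//; [rewrite muleC setIC | exact: measurable_arm_eq].
    + apply/measurable_EFinP; apply: measurable_indic; exact: measurable_arm_eq.
  - move=> n; apply: emeasurable_funM => //.
    apply/measurable_EFinP; apply: measurable_indic; exact: measurable_arm_eq.
  - by move=> n x _; rewrite mule_ge0 ?lee_fin.
apply: eq_integral => w wC.
rewrite (bigD1 (Ordinal (aA w)))//= big1 ?adde0.
  by rewrite indicE mem_set//= mule1.
move=> i; rewrite -val_eqE /= => ia; rewrite indicE memNset/= ?mule0//.
by move=> /esym/eqP; apply/negP.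
Qed.

Lemma reward_extT : reward_ext setT = 1%E.
Proof.
rewrite -setXTT reward_extE// (eq_integral (cst 1%E)); last by move=> w _; rewrite probability_setT.
by rewrite integral_cst// [X in (_ * X)%E]probability_setT mule1.
Qed.
HB.instance Definition _ := Measure.on reward_ext.
HB.instance Definition _ := Measure_isProbability.Build _ _ _ reward_ext reward_extT.

Definition seed_ext : {measure set (W * mR * mR) -> \bar R} := (reward_ext \x uniform_prob (@ltr01 R))%E.
Lemma seed_extE C D : measurable C -> measurable D -> seed_ext (C `*` D) = (reward_ext C * uniform_prob (@ltr01 R) D)%E.
Proof. by move=> mC mD; rewrite /seed_ext /= product_measure1E. Qed.
Lemma seed_extT : seed_ext setT = 1%E.
Proof. by rewrite -setXTT seed_extE// [reward_ext _]probability_setT [X in (_ * X)%E]probability_setT mule1. Qed.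
HB.instance Definition _ := Measure.on seed_ext.
HB.instance Definition _ := Measure_isProbability.Build _ _ _ seed_ext seed_extT.
Definition extension : probability (W * mR * mR)%type R := seed_ext.

Lemma extension_past C : measurable C -> extension ((fun z => z.1.1) @^-1` C) = P C.
Proof.
move=> mC; rewrite /extension.
have -> : (fun z : W * mR * mR => z.1.1) @^-1` C = (C `*` setT) `*` setT.
  by apply/seteqP; split => z /=; tauto.
rewrite seed_extE//; last exact: measurableX.
rewrite [X in (_ * X)%E]probability_setT mule1 reward_extE//.
rewrite (eq_integral (cst 1%E)) ?integral_cst ?mul1e// => w _.
by rewrite probability_setT.
Qed.

Lemma integral_extension C (f : W -> \bar R) : measurable C -> measurable_fun setT f -> (forall w, 0 <= f w)%E ->
  (\int[extension]_(z in (fun z => z.1.1) @^-1` C) f z.1.1 = \int[P]_(w in C) f w)%E.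
Proof.
move=> mC mf f0.
have mp : measurable_fun setT (fun z : W * mR * mR => z.1.1).
  exact: measurableT_comp.
rewrite -(@ge0_integral_pushforward _ _ _ _ R (fun z : W * mR * mR => z.1.1) mp extension C f)//.
- apply: eq_measure_integral => B mB _; exact: extension_past.
- exact: measurable_funTS.
Qed.
End extension.

Definition mfun_of (R : realType) d (W : measurableType d) (f : W -> measurableTypeR R) (mf : measurable_fun setT f) : {mfun W >-> measurableTypeR R} :=
  mfun_Sub (mem_set mf).

Section existence.
Context (R : realType) (A : nat) (pi : strategy R A) (nu : bandit_instance R A).
Local Notation mR := (measurableTypeR R).

Lemma measurable_window d (W : measurableType d) (X : nat -> W -> mR) m n :
  (forall i, (m <= i < m + n)%N -> measurable_fun setT (X i)) -> measurable_fun setT (window X m n).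
Proof.
move=> mX; apply/measurable_fun_tnthP => i.
rewrite (_ : _ \o _ = X (m + i)%N); last by apply/funext => w /=; rewrite /window tnth_mktuple.
by apply: mX; rewrite leq_addr/= ltn_add2l.
Qed.

Lemma eq_window (W W' : Type) (X : nat -> W -> mR) (X' : nat -> W' -> mR) m n w w' :
  (forall i, (m <= i < m + n)%N -> X i w = X' i w') -> window X m n w = window X' m n w'.
Proof.
move=> e; apply: eq_from_tnth => i; rewrite !tnth_mktuple; apply: e.
by rewrite leq_addr/= ltn_add2l.
Qed.

Section extra_round.
Variables (T : nat) (M : interaction T pi nu).
Let W := sample_space M.
Let obs := observation M.
Lemma measurable_observation i : (1 <= i < 1 + T)%N -> measurable_fun setT (obs i).
Proof.
elim/ltn_ind: i => -[//|i] IH /= iT.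
rewrite /obs /observation; apply: measurable_funM => //.
  exact: (@measurable_funPT _ _ _ _ (reward M i.+1)).
apply: (@measurableT_comp _ _ _ _ _ _ (fun b : bool => b%:R : mR)) => //.
have -> : query M i.+1 = (fun h => (decide pi h).2) \o (fun w => (window (seed M) 0 i.+1 w, window (observation M) 1 i w)).
  by apply/funext => w /=; rewrite -decision_rule.
apply: measurableT_comp; first exact: measurable_decide_query.
apply: measurable_fun_pair; apply: measurable_window => // j ji.
apply: IH; lia.
Qed.
Let H w := (window (seed M) 0 T.+1 w, window obs 1 T w).
Let mH : measurable_fun setT H.
Proof. by apply: measurable_fun_pair; apply: measurable_window => // j ji; apply: measurable_observation. Qed.
Let a w := nat_of_ord (decide pi (H w)).1.
Let ma : measurable_fun setT a.
Proof. exact: (measurableT_comp (@measurable_decide_arm _ _ pi T) mH). Qed.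
Let a0 : 'I_A := (decide pi (H point)).1.
Let nun n : probability mR R := nu (insubd a0 n).
Let nuE w : nun (a w) = nu (decide pi (H w)).1.
Proof. by rewrite /nun /a valKd. Qed.
Let aA w : (a w < A)%N. Proof. exact: ltn_ord. Qed.
Let P' := extension (prob M) nun ma aA.
Let W' := (W * mR * mR)%type.
Let U' t (z : W') : mR := if (t <= T)%N then seed M t z.1.1 else z.2.
Let R' t (z : W') : mR := if (t <= T)%N then reward M t z.1.1 else z.1.2.
Let arm' t (z : W') := if (t <= T)%N then arm M t z.1.1 else (decide pi (H z.1.1)).1.
Let qry' t (z : W') := if (t <= T)%N then query M t z.1.1 else (decide pi (H z.1.1)).2.
Let mp : measurable_fun setT (fun z : W' => z.1.1).
Proof. exact: (measurableT_comp measurable_fst measurable_fst). Qed.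
Let mU t : measurable_fun setT (U' t).
Proof.
rewrite /U'; case: (leqP t T) => _; last exact: measurable_snd.
exact: (measurableT_comp (@measurable_funPT _ _ _ _ (seed M t)) mp).
Qed.
Let mR' t : measurable_fun setT (R' t).
Proof.
rewrite /R'; case: (leqP t T) => _; last first.
  exact: (measurableT_comp measurable_snd measurable_fst).
exact: (measurableT_comp (@measurable_funPT _ _ _ _ (reward M t)) mp).
Qed.

Let wU n (z : W') : (n <= T.+1)%N -> window U' 0 n z = window (seed M) 0 n z.1.1.
Proof. by move=> nT; apply: eq_window => i iN; rewrite /U' (_ : (i <= T)%N)//; lia. Qed.
Let wR n (z : W') : (n <= T)%N -> window R' 1 n z = window (reward M) 1 n z.1.1.
Proof. by move=> nT; apply: eq_window => i iN; rewrite /R' (_ : (i <= T)%N)//; lia. Qed.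
Let marm t : (t < T)%N -> measurable_fun setT (fun w => nat_of_ord (arm M t.+1 w)).
Proof.
move=> tT.
rewrite (_ : (fun w => _) = (fun h => nat_of_ord (decide pi h).1) \o (fun w => (window (seed M) 0 t.+1 w, window (observation M) 1 t w))).
  apply: measurableT_comp; first exact: measurable_decide_arm.
  by apply: measurable_fun_pair; apply: measurable_window => // j ji; apply: measurable_observation; lia.
by apply/funext => w /=; rewrite -decision_rule.
Qed.

Let mpast m n : (n <= T)%N -> forall C : set (trace R m n), measurable C ->
  measurable [set w | C (window (seed M) 0 m w, window (reward M) 1 n w)].
Proof.
move=> nT C mC; rewrite -[X in measurable X]setTI.
have := @measurable_fun_pair _ _ _ _ _ _ (window (seed M) 0 m) (window (reward M) 1 n).
by move=> mm; apply: mm => //; apply: measurable_window.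
Qed.

Lemma interactionS : interaction T.+1 pi nu.
Proof.
refine (@Interaction R A T.+1 pi nu _ W' P' (fun t => mfun_of (mU t)) (fun t => mfun_of (mR' t)) arm' qry' _ _ _).
- move=> t z; rewrite ltnS => tT /=.
  have -> : window (fun t => mfun_of (mU t)) 0 t.+1 z = window (seed M) 0 t.+1 z.1.1 by exact: wU.
  rewrite (@eq_window _ _ _ obs 1 t z z.1.1); last first.
    by move=> i it; rewrite /= /R' /qry' (_ : (i <= T)%N)//; lia.
  rewrite /arm' /qry'; case: (ltnP t T) => tT'; first exact: decision_rule.
  have tE : t = T by lia.
  by subst t; rewrite -surjective_pairing.
- move=> t tT C D mC mD.
  change (P' [set z | C (window U' 0 t z, window R' 1 t z) /\ D (U' t z)] =
    (P' [set z | C (window U' 0 t z, window R' 1 t z)] * uniform_prob (@ltr01 R) D)%E).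
  case: (leqP t T) => tT'.
    have e z : (window U' 0 t z, window R' 1 t z) = (window (seed M) 0 t z.1.1, window (reward M) 1 t z.1.1).
      by rewrite wU ?wR//; lia.
    under eq_set do rewrite e.
    under [in RHS]eq_set do rewrite e.
    rewrite (_ : [set z | _ ] = (fun z : W' => z.1.1) @^-1` [set w | C (window (seed M) 0 t w, window (reward M) 1 t w) /\ D (seed M t w)]); last first.
      by apply/seteqP; split => z /=; rewrite /U' tT'.
    rewrite extension_past; last first.
      apply: measurableI; first exact: mpast.
      by rewrite -[X in measurable X]setTI; apply: measurable_funP.
    rewrite seed_law//; congr (_ * _)%E; symmetry; apply: extension_past; exact: mpast.
  have tE : t = T.+1 by lia. subst t.
  pose C' := [set y : W * mR | C (window U' 0 T.+1 (y, point), window R' 1 T.+1 (y, point))].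
  have e z : C (window U' 0 T.+1 z, window R' 1 T.+1 z) = C' z.1.
    rewrite /C'/= !(@eq_window _ _ U' U' 0 T.+1 z (z.1, point)) ?(@eq_window _ _ R' R' 1 T.+1 z (z.1, point))//.
    by move=> i iT; rewrite /U' (_ : (i <= T)%N)//; lia.
  have mC' : measurable C'.
    rewrite /C' -[X in measurable X]setTI.
    have mpr : measurable_fun setT (fun y : W * mR => (y, point : mR)) by exact: measurable_fun_pair.
    have := @measurable_fun_pair _ _ _ _ _ _ (window U' 0 T.+1 \o (fun y : W * mR => (y, point : mR)))
      (window R' 1 T.+1 \o (fun y : W * mR => (y, point : mR))).
    by move=> mm; apply: mm => //; apply: measurableT_comp => //; apply: measurable_window.
  under eq_set do rewrite e.
  under [in RHS]eq_set do rewrite e.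
  rewrite (_ : [set z | _ ] = C' `*` D); last first.
    by apply/seteqP; split => z /=; rewrite /U' ltnn.
  rewrite (_ : [set z : W' | C' z.1 ] = C' `*` setT); last first.
    by apply/seteqP; split => z //= [].
  rewrite /P' /extension !seed_extE//.
  by rewrite [X in (_ = _ * X * _)%E]probability_setT mule1.
- move=> t tT C D mC mD.
  change (P' [set z | C (window U' 0 t.+1 z, window R' 1 t z) /\ D (R' t.+1 z)] =
    (\int[P']_(z in [set z | C (window U' 0 t.+1 z, window R' 1 t z)]) nu (arm' t.+1 z) D)%E).
  rewrite ltnS in tT.
  have e z : (window U' 0 t.+1 z, window R' 1 t z) = (window (seed M) 0 t.+1 z.1.1, window (reward M) 1 t z.1.1).
    by rewrite wU ?wR//; lia.
  under eq_set do rewrite e.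
  under [in RHS]eq_set do rewrite e.
  pose C' := [set w | C (window (seed M) 0 t.+1 w, window (reward M) 1 t w)].
  have mC' : measurable C' by exact: mpast.
  case: (ltnP t T) => tT'.
    rewrite (_ : [set z | _ ] = (fun z : W' => z.1.1) @^-1` [set w | C (window (seed M) 0 t.+1 w, window (reward M) 1 t w) /\ D (reward M t.+1 w)]); last first.
      by apply/seteqP; split => z /=; rewrite /R' tT'.
    rewrite extension_past; last first.
      apply: measurableI; first exact: mpast.
      by rewrite -[X in measurable X]setTI; apply: measurable_funP.
    rewrite reward_cond_law//.
    transitivity (\int[P']_(z in (fun z : W' => z.1.1) @^-1` C') nu (arm M t.+1 z.1.1) D)%E; last first.
      by apply: eq_integral => z _; rewrite /arm' tT'.
    rewrite (@integral_extension _ _ _ _ _ _ _ _ _ C' (fun w => nu (arm M t.+1 w) D))//.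
    rewrite (_ : (fun w => _) = (fun n => nu (insubd a0 n) D) \o (fun w => nat_of_ord (arm M t.+1 w))).
      by apply: measurableT_comp; [| exact: marm].
    by apply/funext => w /=; rewrite valKd.
  have tE : t = T by lia. subst t.
  transitivity (\int[P']_(z in (fun z : W' => z.1.1) @^-1` C') nun (a z.1.1) D)%E; last first.
    by apply: eq_integral => z _; rewrite /arm' ltnn nuE.
  rewrite (@integral_extension _ _ _ _ _ _ _ _ _ C' (fun w => nun (a w) D))//; last first.
    exact: (@measurableT_comp _ _ _ _ _ _ (fun n => nun n D)).
  rewrite (_ : [set z | _ ] = (C' `*` D) `*` setT); last first.
    by apply/seteqP; split => z /=; rewrite /R' ltnn; tauto.
  rewrite /P' /extension seed_extE//; last exact: measurableX.
  by rewrite [X in (_ * X = _)%E]probability_setT mule1 reward_extE.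
Qed.
End extra_round.

Lemma interaction0 : interaction 0 pi nu.
Proof.
have mid : measurable_fun setT (id : mR -> mR) by [].
have mc : measurable_fun setT (cst 0 : mR -> mR) by [].
pose a0 := (decide pi ([tuple (0 : mR) | _ < 1], [tuple (0:mR) | _ < 0])).1.
refine (@Interaction R A 0 pi nu _ mR (uniform_prob (@ltr01 R)) (fun t => mfun_of mid) (fun t => mfun_of mc) (fun _ _ => a0) (fun _ _ => false) _ _ _) => //.
move=> [|//] _ C D mC mD.
set x := uniform_prob _.
have e (X : nat -> mR -> mR) m w : window X m 0 w = [tuple].
  exact: tuple0.
under eq_set do rewrite !e.
under [in RHS]eq_set do rewrite !e.
have [c|c] := pselect (C ([tuple],[tuple])).
  rewrite (_ : [set _ | C _] = setT); last by apply/seteqP; split.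
  rewrite [X in (_ = X * _)%E]probability_setT mul1e; congr (x _).
  by apply/seteqP; split => z //= [].
rewrite (_ : [set _ | C _] = set0); last by apply/seteqP; split.
rewrite measure0 mul0e (_ : [set _ | _ /\ _] = set0) ?measure0//.
by apply/seteqP; split => z //= [].
Qed.

Lemma interaction_exists T : inhabited (interaction T pi nu).
Proof. constructor; elim: T => [|T IH]; [exact: interaction0 | exact: interactionS IH]. Qed.
End existence.

End InteractionExists.

(* Main.v *)
(** Two-point method, with a change of measure that only charges queried rounds.
    Run the strategy on the bandit whose arms are all Bernoulli(1/2), and let
    N_a be the expected number of queries of arm a.  As the sum of c(a) N_a is
    at most B, some arm a has N_a <= B / S, where S is the sum of the costs.
    Let x = m / 10 with m = min(1, sqrt (S / B)).  If a is played in at most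
    half of the rounds on average, raise its mean to 1/2 + x, otherwise lower
    it to 1/2 - x.  The divergence between the laws of the observations on the
    two bandits is of order x^2 N_a, hence at most a small constant, so the
    probability that a is played at a given round changes by at most 1/3, and
    the expected regret on the modified bandit is at least x T / 6 = m T / 60. *)

Require Import Defs.
From HB Require Import structures.
From mathcomp Require Import all_boot all_order all_algebra.
From mathcomp Require Import all_classical all_reals all_analysis.
From mathcomp Require Import measurable_realfun measurable_function ring lra zify.
Import Order.TTheory GRing.Theory Num.Theory.
Import numFieldNormedType.Exports.
Import InteractionExists.

Set Implicit Arguments.
Unset Strict Implicit.
Unset Printing Implicit Defensive.

Local Open Scope classical_set_scope.
Local Open Scope ring_scope.

(** * Restricted measures, image measures and Tonelli for independent variables *)

Section restriction.
Context d (W : measurableType d) (R : realType).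

(** The restricted measure vanishes off [E]. This turns an integral over an event such as a choice
    of arm into an integral over the whole space, where independence can be applied. *)
Lemma ge0_integral_mrestr (m : {measure set W -> \bar R}) (E : set W)
    (mE : measurable E) (f : W -> \bar R) :
  measurable_fun setT f -> (forall w, 0 <= f w)%E ->
  (\int[mrestr m mE]_w f w = \int[m]_(w in E) f w)%E.
Proof.
move=> mf f0; have mEC : measurable (~` E) by exact: measurableC.
rewrite -(setUv E) ge0_integral_setU ?setUv//; last exact/disj_setPCl.
rewrite [X in (_ + X)%E](@null_set_integral _ _ _ _ (~` E)) ?adde0//; last 2 first.
- exact: measurable_funTS.
- by rewrite /= /mrestr setICl measure0.
by apply: eq_measure_integral => A mA AE; rewrite /= /mrestr setIidl.
Qed.

End restriction.

Section image_measure.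
Context d d' (W : measurableType d) (T : measurableType d') (R : realType).
Variables (m : {finite_measure set W -> \bar R}) (X : {mfun W >-> T}).

(** The pushforward under its own name, so that it can carry the finite-measure structure used when
    forming the product with the reward or seed law. *)
Definition image_measure : set T -> \bar R := pushforward m X.

Let image_measure0 : image_measure set0 = 0%E.
Proof. exact: measure0. Qed.

Let image_measure_ge0 A : (0 <= image_measure A)%E.
Proof. exact: measure_ge0. Qed.

Let image_measure_sigma_additive : semi_sigma_additive image_measure.
Proof. exact: measure_semi_sigma_additive. Qed.

HB.instance Definition _ := isMeasure.Build _ _ _ image_measure
  image_measure0 image_measure_ge0 image_measure_sigma_additive.

Let image_measure_fin : fin_num_fun image_measure.
Proof.
by move=> A mA; apply: fin_num_measure; rewrite -[X in measurable X]setTI; exact: measurable_funP.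
Qed.

HB.instance Definition _ := Measure_isFinite.Build _ _ _ image_measure image_measure_fin.

End image_measure.

Section conditional_fubini.
Context d d1 d2 (W : measurableType d) (T1 : measurableType d1)
  (T2 : measurableType d2) (R : realType).

(** The hypothesis on rectangles identifies the law of (X, Y) with a product measure, and Tonelli
    applies. The measure [m] is only finite because it will also be a probability restricted to an
    event. *)
Lemma ge0_integral_indep (m : {finite_measure set W -> \bar R}) (nu : probability T2 R)
    (X : W -> T1) (Y : W -> T2) (F : T1 * T2 -> \bar R) :
  measurable_fun setT X -> measurable_fun setT Y ->
  (forall C D, measurable C -> measurable D ->
    m (X @^-1` C `&` Y @^-1` D) = m (X @^-1` C) * nu D)%E ->
  measurable_fun setT F -> (forall z, 0 <= F z)%E ->
  (\int[m]_w F (X w, Y w) = \int[m]_w \int[nu]_y F (X w, y))%E.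
Proof.
move=> mX mY XY mF F0.
have mXY : measurable_fun setT (fun w => (X w, Y w)) by exact: measurable_fun_pair.
pose mX' : {mfun W >-> T1} := mfun_Sub (mem_set mX).
transitivity (\int[pushforward m (fun w => (X w, Y w))]_z F z)%E.
  by rewrite ge0_integral_pushforward.
transitivity (\int[image_measure m mX' \x nu]_z F z)%E.
  apply: eq_measure_integral => A mA _; symmetry.
  by apply: product_measure_unique mA => C D mC mD; rewrite -XY.
rewrite fubini_tonelli1//.
rewrite (@ge0_integral_pushforward _ _ _ _ _ X mX)//.
  exact: measurable_fun_fubini_tonelli_F.
by move=> y _; exact: integral_ge0.
Qed.

Lemma measurable_integral_section (nu : probability T2 R) (F : T1 * T2 -> \bar R) :
  measurable_fun setT F -> (forall z, 0 <= F z)%E ->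
  measurable_fun setT (fun x => \int[nu]_y F (x, y))%E.
Proof. by move=> mF F0; exact: measurable_fun_fubini_tonelli_F. Qed.

End conditional_fubini.

(** * Growing tuples and windows, and their measurability *)

Section snoc.
Context (T : Type) (n : nat).

(** The coordinatewise form lets measurability be checked one coordinate at a time. *)
Definition snoc (x : n.-tuple T) (y : T) : n.+1.-tuple T :=
  [tuple if unlift ord_max i is Some j then tnth x j else y | i < n.+1].

Definition front (x : n.+1.-tuple T) : n.-tuple T :=
  [tuple tnth x (lift ord_max i) | i < n].

Lemma front_snoc x y : front (snoc x y) = x.
Proof. by apply: eq_from_tnth => i; rewrite !tnth_mktuple liftK. Qed.

Lemma last_snoc x y : tnth (snoc x y) ord_max = y.
Proof. by rewrite tnth_mktuple unlift_none. Qed.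

End snoc.

Section windows.
Context (R : realType) (Omega : Type).
Local Notation mR := (measurableTypeR R).
Implicit Types (X : nat -> Omega -> mR) (m n : nat) (w : Omega).

Lemma front_window X m n w : front (window X m n.+1 w) = window X m n w.
Proof.
by apply: eq_from_tnth => i; rewrite !tnth_mktuple lift_max.
Qed.

Lemma last_window X m n w : tnth (window X m n.+1 w) ord_max = X (m + n)%N w.
Proof. by rewrite tnth_mktuple. Qed.

Lemma snoc_window X m n w : snoc (window X m n w) (X (m + n)%N w) = window X m n.+1 w.
Proof.
apply: eq_from_tnth => i; rewrite !tnth_mktuple.
by case: unliftP => [j ->|->]; rewrite ?tnth_mktuple ?lift_max.
Qed.

End windows.

Section measurable_snoc.
Context (R : realType) d (W : measurableType d).
Local Notation mR := (measurableTypeR R).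

Lemma measurable_snoc n (f : W -> n.-tuple mR) (g : W -> mR) :
  measurable_fun setT f -> measurable_fun setT g ->
  measurable_fun setT (fun w => snoc (f w) (g w)).
Proof.
move=> mf mg; apply/measurable_fun_tnthP => i.
rewrite (_ : _ \o _ = fun w => if unlift ord_max i is Some j then tnth (f w) j else g w).
  by case: (unlift _ _) => [j|//]; move/measurable_fun_tnthP : mf; exact.
by apply/funext => w /=; rewrite tnth_mktuple.
Qed.

Lemma measurable_front n (f : W -> n.+1.-tuple mR) :
  measurable_fun setT f -> measurable_fun setT (fun w => front (f w)).
Proof.
move=> /measurable_fun_tnthP mf; apply/measurable_fun_tnthP => i.
rewrite (_ : _ \o _ = fun w => tnth (f w) (lift ord_max i)); first exact: mf.
by apply/funext => w /=; rewrite tnth_mktuple.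
Qed.

Lemma measurable_tnthT n (f : W -> n.-tuple mR) i :
  measurable_fun setT f -> measurable_fun setT (fun w => tnth (f w) i).
Proof. by move=> /measurable_fun_tnthP /(_ i). Qed.

Lemma measurable_nat_of_bool (q : W -> bool) :
  measurable_fun setT q -> measurable_fun setT (fun w => (q w)%:R : mR).
Proof.
exact: (@measurableT_comp _ _ _ _ _ _ (fun b : bool => b%:R : mR)).
Qed.

Variable A : nat.
Variable a : W -> 'I_A.
Hypothesis ma : measurable_fun setT (fun w => nat_of_ord (a w)).

Lemma measurable_arm_preimage b : measurable [set w | a w = b].
Proof.
rewrite (_ : [set w | _] = (fun w => nat_of_ord (a w)) @^-1` [set nat_of_ord b]).
  by rewrite -[X in measurable X]setTI; exact: ma.
by apply/seteqP; split => w /= [e]; [rewrite e | exact: val_inj].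
Qed.

(** A preimage is the finite union, over the arms b, of the event that b is selected intersected
    with a preimage under [g b]. *)
Lemma measurable_fun_select d' (V : measurableType d') (g : 'I_A -> W -> V) :
  (forall b, measurable_fun setT (g b)) -> measurable_fun setT (fun w => g (a w) w).
Proof.
move=> mg _ Y mY; rewrite setTI.
rewrite (_ : _ @^-1` _ = \big[setU/set0]_(b < A) ([set w | a w = b] `&` g b @^-1` Y)).
  apply: bigsetU_measurable => b _; apply: measurableI.
    exact: measurable_arm_preimage.
  by rewrite -[X in measurable X]setTI; exact: mg.
rewrite -bigcup_seq; apply/seteqP; split => w /=.
  by move=> Yw; exists (a w) => //=; rewrite mem_index_enum.
by move=> [b _ /= [<-]].
Qed.

End measurable_snoc.

(** * The law of an interaction: integrating out one seed or one reward *)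

Section interaction_law.
Context (R : realType) (A : nat) (pi : strategy R A).
Local Notation mR := (measurableTypeR R).

(* [observe t u r] computes (Y_1, ..., Y_t) from u = (U_0, ..., U_(t-1)) and
   r = (R_1, ..., R_t). *)
Fixpoint observe t : t.-tuple mR -> t.-tuple mR -> t.-tuple mR :=
  match t with
  | 0 => fun _ _ => [tuple]
  | t.+1 => fun u r =>
      let y := observe (front u) (front r) in
      snoc y (tnth r ord_max * (decide pi (u, y)).2%:R)
  end.

Lemma measurable_observe t :
  measurable_fun setT (fun h : trace R t t => observe h.1 h.2).
Proof.
elim: t => [|t IH] /=; first exact: measurable_cst.
have my : measurable_fun setT (fun h : trace R t.+1 t.+1 => observe (front h.1) (front h.2)).
  apply: (measurableT_comp IH (g := fun h : trace R t.+1 t.+1 => (front h.1, front h.2))).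
  by apply: measurable_fun_pair; exact: measurable_front.
apply: measurable_snoc => //; apply: measurable_funM.
  exact: measurable_tnthT.
apply: measurable_nat_of_bool.
apply: (measurableT_comp (measurable_decide_query pi (t := t))
  (g := fun h : trace R t.+1 t.+1 => (h.1, observe (front h.1) (front h.2)))).
by apply: measurable_fun_pair.
Qed.

Section law.
Context (T : nat) (nu : bandit_instance R A) (M : interaction T pi nu).

(** This is I_t, which determines the decision of round t + 1. *)
Definition history t (w : sample_space M) : trace R t.+1 t :=
  (window (seed M) 0 t.+1 w, window (observation M) 1 t w).

(** The axioms of an interaction concern the past seeds and rewards. Writing the observations as a
    function of these transfers the axioms to events about the observed history. *)
Lemma observe_window t w : (t <= T)%N ->
  observe (window (seed M) 0 t w) (window (reward M) 1 t w) =
  window (observation M) 1 t w.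
Proof.
elim: t => [|t IH] tT /=; first by rewrite [RHS]tuple0.
rewrite !front_window last_window IH; last exact: ltnW.
rewrite -[RHS]snoc_window.
by rewrite -decision_rule.
Qed.

Lemma measurable_rv (X : nat -> {RV (prob M) >-> mR}) m n :
  measurable_fun setT (window X m n).
Proof. by apply: measurable_window => i _; exact: measurable_funP. Qed.

Lemma measurable_window_observation t : (t <= T)%N ->
  measurable_fun setT (window (observation M) 1 t).
Proof. by move=> tT; apply: measurable_window => i it; apply: measurable_observation; lia. Qed.

Lemma measurable_history t : (t <= T)%N -> measurable_fun setT (history t).
Proof.
move=> tT; apply: measurable_fun_pair; first exact: measurable_rv.
exact: measurable_window_observation.
Qed.

Lemma armE t w : (t < T)%N -> arm M t.+1 w = (decide pi (history t w)).1.
Proof. by move=> tT; rewrite -decision_rule. Qed.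

Lemma queryE t w : (t < T)%N -> query M t.+1 w = (decide pi (history t w)).2.
Proof. by move=> tT; rewrite -decision_rule. Qed.

Lemma measurable_arm t : (t < T)%N ->
  measurable_fun setT (fun w => nat_of_ord (arm M t.+1 w)).
Proof.
move=> tT; rewrite (_ : (fun w => _) = (fun h => nat_of_ord (decide pi h).1) \o history t).
  apply: measurableT_comp; first exact: measurable_decide_arm.
  exact: measurable_history (ltnW tT).
by apply/funext => w /=; rewrite armE.
Qed.

Lemma measurable_query t : (t < T)%N -> measurable_fun setT (query M t.+1).
Proof.
move=> tT; rewrite (_ : query M t.+1 = (fun h => (decide pi h).2) \o history t).
  apply: measurableT_comp; first exact: measurable_decide_query.
  exact: measurable_history (ltnW tT).
by apply/funext => w /=; rewrite queryE.
Qed.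

Lemma integral_seed t (F : trace R t t * mR -> \bar R) : (t <= T)%N ->
  measurable_fun setT F -> (forall z, 0 <= F z)%E ->
  (\int[prob M]_w F ((window (seed M) 0 t w, window (observation M) 1 t w), seed M t w) =
   \int[prob M]_w \int[uniform_prob (@ltr01 R)]_u
     F ((window (seed M) 0 t w, window (observation M) 1 t w), u))%E.
Proof.
move=> tT mF F0; apply: (ge0_integral_indep (m := prob M)
  (X := fun w => (window (seed M) 0 t w, window (observation M) 1 t w))) => //.
- by apply: measurable_fun_pair; [exact: measurable_rv|exact: measurable_window_observation].
- move=> C D mC mD.
  pose C' := (fun h : trace R t t => (h.1, observe h.1 h.2)) @^-1` C.
  have mC' : measurable C'.
    rewrite /C' -[X in measurable X]setTI.
    have mo : measurable_fun setT (fun h : trace R t t => (h.1, observe h.1 h.2)).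
      by apply: measurable_fun_pair => //; exact: measurable_observe.
    exact: mo.
  have := seed_law M tT mC' mD; rewrite /C' /=.
  by under eq_set do rewrite observe_window//;
    under [in RHS]eq_set do rewrite observe_window//.
Qed.

Lemma integral_arm t (f : sample_space M -> \bar R) : (t < T)%N ->
  measurable_fun setT f -> (forall w, 0 <= f w)%E ->
  (\int[prob M]_w f w =
   \sum_(b < A) \int[prob M]_(w in [set w | arm M t.+1 w = b]) f w)%E.
Proof.
move=> tT mf f0; rewrite -ge0_integral_bigsetU//.
- congr (integral _ _ _); rewrite -bigcup_seq; apply/seteqP; split => w //= _.
  by exists (arm M t.+1 w) => //=; rewrite mem_index_enum.
- by move=> b; apply: measurable_arm_preimage; exact: measurable_arm.
- exact: index_enum_uniq.
- by apply/trivIsetP => b b' _ _ /eqP bb'; apply/seteqP; split => w //= [e e']; case: bb'; rewrite -e -e'.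
- exact: measurable_funTS.
Qed.

(** The law of R_(t+1) depends on the arm, so the reward and the history are not independent. They
    become so under the measure restricted to a_(t+1) = b, where the reward has law [nu b]; the
    integral is therefore split over the arms. *)
Lemma integral_reward t (F : trace R t.+1 t * mR -> \bar R) : (t < T)%N ->
  measurable_fun setT F -> (forall z, 0 <= F z)%E ->
  (\int[prob M]_w F (history t w, reward M t.+1 w) =
   \int[prob M]_w \int[nu (arm M t.+1 w)]_r F (history t w, r))%E.
Proof.
move=> tT mF F0.
have mH := measurable_history (ltnW tT).
have mR' : measurable_fun setT (reward M t.+1) by exact: measurable_funP.
have mFb b : measurable_fun setT (fun w => \int[nu b]_r F (history t w, r))%E.
  exact: (measurableT_comp (measurable_integral_section (nu b) mF F0) mH).
have mfF : measurable_fun setT (fun w => F (history t w, reward M t.+1 w)).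
  by apply: (measurableT_comp mF); exact: measurable_fun_pair.
have F0b b w : (0 <= \int[nu b]_r F (history t w, r))%E by exact: integral_ge0.
rewrite (integral_arm tT)// [RHS](integral_arm tT)//; last first.
  exact: (measurable_fun_select (measurable_arm tT) (g := fun b w => \int[nu b]_r F (history t w, r))%E).
apply: eq_bigr => b _.
have mb := measurable_arm_preimage (measurable_arm tT) b.
transitivity (\int[prob M]_(w in [set w | arm M t.+1 w = b]) \int[nu b]_r F (history t w, r))%E; last first.
  by apply: eq_integral => w; rewrite inE /= => ->.
rewrite -!(ge0_integral_mrestr _ mb)//.
apply: (ge0_integral_indep (m := mrestr (prob M) mb)) => // C D mC mD.
rewrite /= /mrestr.
(* The event is pulled back to seeds and rewards. [front] drops U_t, which does not enter Y_1, ...,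
   Y_t. Including the choice of b makes the integrand of [reward_cond_law] constant. *)
pose C' := (fun h : trace R t.+1 t => (h.1, observe (front h.1) h.2)) @^-1`
  (C `&` [set h | (decide pi h).1 = b]).
have mC' : measurable C'.
  rewrite /C' -[X in measurable X]setTI.
  have mo : measurable_fun setT (fun h : trace R t.+1 t => (h.1, observe (front h.1) h.2)).
    apply: measurable_fun_pair => //.
    apply: (measurableT_comp (@measurable_observe t) (g := fun h : trace R t.+1 t => (front h.1, h.2))).
    by apply: measurable_fun_pair => //; exact: measurable_front.
  apply: mo => //; apply: measurableI => //.
  exact: measurable_arm_preimage (measurable_decide_arm pi (t := t)) b.
have CE w : C' (window (seed M) 0 t.+1 w, window (reward M) 1 t w) <->
    C (history t w) /\ arm M t.+1 w = b.
  by rewrite /C'/= front_window observe_window ?(ltnW tT)// armE.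
have := reward_cond_law M tT mC' mD.
rewrite (_ : [set w | _ /\ _] = history t @^-1` C `&` reward M t.+1 @^-1` D `&` [set w | arm M t.+1 w = b]); last first.
  apply/seteqP; split => w; first by case=> /CE[].
  by case=> -[? ? ?]; split => //; apply/CE.
move=> ->.
rewrite (_ : [set w | C' _] = history t @^-1` C `&` [set w | arm M t.+1 w = b]); last first.
  by apply/seteqP; split => w /CE.
rewrite (eq_integral (cst (nu b D))); last by move=> w; rewrite inE /= => -[_ ->].
rewrite integral_cst; last by apply: measurableI => //; rewrite -[X in measurable X]setTI; exact: mH.
by rewrite muleC.
Qed.

End law.
End interaction_law.

Arguments history {R A pi T nu} M t w.

(** * Change of measure along the history *)

Section change_of_measure.
Context (R : realType) (A : nat) (pi : strategy R A).
Local Notation mR := (measurableTypeR R).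

(** The transition kernel from I_t to I_(t+1), applied to [F]: a reward of the arm chosen at [k] is
    drawn and masked if not queried, then a fresh seed is drawn. *)
Definition one_round (nu : bandit_instance R A) t (F : trace R t.+2 t.+1 -> \bar R) (k : trace R t.+1 t)
    : \bar R :=
  (\int[nu (decide pi k).1]_r \int[uniform_prob (@ltr01 R)]_u
    F (snoc k.1 u, snoc k.2 (r * (decide pi k).2%:R)%R))%E.

Lemma measurable_next t (F : trace R t.+2 t.+1 -> \bar R) :
  measurable_fun setT F ->
  measurable_fun setT (fun z : trace R t.+1 t * mR * mR =>
    F (snoc z.1.1.1 z.2, snoc z.1.1.2 (z.1.2 * (decide pi z.1.1).2%:R))).
Proof.
move=> mF; apply: (measurableT_comp mF
  (g := fun z : trace R t.+1 t * mR * mR => (snoc z.1.1.1 z.2, snoc z.1.1.2 (z.1.2 * (decide pi z.1.1).2%:R)))).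
have m1 : measurable_fun setT (fun z : trace R t.+1 t * mR * mR => z.1.1) by exact: measurableT_comp.
apply: measurable_fun_pair.
  by apply: measurable_snoc => //; exact: (measurableT_comp measurable_fst m1).
apply: measurable_snoc; first exact: (measurableT_comp measurable_snd m1).
apply: measurable_funM; first exact: (measurableT_comp measurable_snd measurable_fst).
apply: measurable_nat_of_bool.
exact: (measurableT_comp (measurable_decide_query pi (t := t)) m1).
Qed.

Lemma measurable_one_round nu t (F : trace R t.+2 t.+1 -> \bar R) :
  measurable_fun setT F -> (forall k, 0 <= F k)%E ->
  measurable_fun setT (one_round nu F).
Proof.
move=> mF F0.
have m1 := measurable_integral_section (uniform_prob (@ltr01 R)) (measurable_next mF) (fun=> F0 _).
have m2 b := measurable_integral_section (nu b) m1
  (fun z => integral_ge0 _ (fun u _ => F0 _)).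
exact: (measurable_fun_select (measurable_decide_arm pi (t := t)) m2).
Qed.

Section one_round.
Context (T : nat) (nu : bandit_instance R A) (M : interaction T pi nu).

Lemma integral_history0 (F : trace R 1 0 -> \bar R) :
  measurable_fun setT F -> (forall k, 0 <= F k)%E ->
  (\int[prob M]_w F (history M 0 w) =
   \int[uniform_prob (@ltr01 R)]_u F (snoc [tuple] u, [tuple]))%E.
Proof.
move=> mF F0.
pose G (z : trace R 0 0 * mR) := F (snoc z.1.1 z.2, z.1.2).
have mG : measurable_fun setT G.
  apply: (measurableT_comp mF); apply: measurable_fun_pair.
    apply: measurable_snoc => //.
    by apply: measurableT_comp.
  by apply: measurableT_comp.
transitivity (\int[prob M]_w G (window (seed M) 0 0 w, window (observation M) 1 0 w, seed M 0 w))%E.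
  by apply: eq_integral => w _; rewrite /G /= (snoc_window (seed M) 0).
rewrite (integral_seed M (t := 0))//; last by move=> z; exact: F0.
rewrite (eq_integral (cst (\int[uniform_prob (@ltr01 R)]_u F (snoc [tuple] u, [tuple]))%E)).
  by rewrite integral_cst// [X in (_ * X)%E]probability_setT mule1.
by move=> w _; rewrite /G /= !(tuple0 (window _ _ _ _)).
Qed.

(** The seed U_(t+1) is integrated out first, being independent of everything up to R_(t+1); what
    remains is a function of I_t and R_(t+1), to which [integral_reward] applies. *)
Lemma integral_history t (F : trace R t.+2 t.+1 -> \bar R) : (t < T)%N ->
  measurable_fun setT F -> (forall k, 0 <= F k)%E ->
  (\int[prob M]_w F (history M t.+1 w) =
   \int[prob M]_w one_round nu F (history M t w))%E.
Proof.
move=> tT mF F0.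
pose G (z : trace R t.+1 t.+1 * mR) := F (snoc z.1.1 z.2, z.1.2).
have mG : measurable_fun setT G.
  apply: (measurableT_comp mF); apply: measurable_fun_pair.
    apply: measurable_snoc => //.
    exact: (measurableT_comp measurable_fst measurable_fst).
  exact: (measurableT_comp measurable_snd measurable_fst).
transitivity (\int[prob M]_w G (window (seed M) 0 t.+1 w, window (observation M) 1 t.+1 w, seed M t.+1 w))%E.
  by apply: eq_integral => w _; rewrite /G /= (snoc_window (seed M) 0).
rewrite (integral_seed M tT)//; last by move=> z; exact: F0.
have m1 := measurable_integral_section (uniform_prob (@ltr01 R)) (measurable_next mF) (fun=> F0 _).
transitivity (\int[prob M]_w \int[uniform_prob (@ltr01 R)]_u
    F (snoc (history M t w).1 u,
       snoc (history M t w).2 (reward M t.+1 w * (decide pi (history M t w)).2%:R)%R))%E.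
  apply: eq_integral => w _; apply: eq_integral => u _; rewrite /G /=.
  by rewrite -[window (observation M) 1 t.+1 w]snoc_window -queryE.
rewrite (integral_reward M tT m1); last by move=> z; exact: integral_ge0.
by apply: eq_integral => w _; rewrite /one_round -armE.
Qed.

End one_round.

Section likelihood.
Variable rho : 'I_A -> R -> R.
Hypothesis mrho : forall b, measurable_fun setT (rho b : mR -> mR).
Hypothesis rho0 : forall b y, 0 <= rho b y.

(* Unqueried rounds reveal nothing about the reward, so they contribute no factor. *)
Fixpoint likelihood t : trace R t.+1 t -> R :=
  match t with
  | 0 => fun=> 1
  | t.+1 => fun h =>
      let k := (front h.1, front h.2) in
      likelihood k *
      (if (decide pi k).2 then rho (decide pi k).1 (tnth h.2 ord_max) else 1)
  end.

Lemma likelihood_ge0 t (h : trace R t.+1 t) : 0 <= likelihood h.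
Proof. by elim: t h => [|t IH] h //=; rewrite mulr_ge0//; case: ifP. Qed.

Lemma measurable_likelihood t : measurable_fun setT (@likelihood t : _ -> mR).
Proof.
elim: t => [|t IH] /=; first exact: measurable_cst.
have mk : measurable_fun setT (fun h : trace R t.+2 t.+1 => (front h.1, front h.2)).
  by apply: measurable_fun_pair; exact: measurable_front.
apply: measurable_funM; first exact: (measurableT_comp IH mk).
apply: measurable_fun_ifT => //.
  exact: (measurableT_comp (measurable_decide_query pi (t := t)) mk).
have ma := measurableT_comp (measurable_decide_arm pi (t := t)) mk.
apply: (measurable_fun_select ma (g := fun b (h : trace R t.+2 t.+1) => rho b (tnth h.2 ord_max) : mR)) => b.
apply: (measurableT_comp (mrho b)); exact: measurable_tnthT.
Qed.

Lemma likelihood_history T (nu : bandit_instance R A) (M : interaction T pi nu) t w :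
  (t <= T)%N -> likelihood (history M t w) =
  \prod_(0 <= s < t) (if query M s.+1 w then rho (arm M s.+1 w) (observation M s.+1 w) else 1).
Proof.
elim: t => [|t IH] tT; first by rewrite big_geq.
rewrite big_nat_recr//= !front_window last_window -[(_, _)]/(history M t w).
by rewrite IH ?(ltnW tT)// armE// queryE.
Qed.

(** Induction on t. The last round is peeled off under nu', the induction hypothesis moves the rest
    to nu, and it remains to compare a single round under the two laws for a fixed history [k]. *)
Lemma change_of_measure T (nu nu' : bandit_instance R A)
    (M : interaction T pi nu) (M' : interaction T pi nu') :
  (forall b (F : mR -> \bar R), measurable_fun setT F -> (forall y, 0 <= F y)%E ->
     (\int[nu' b]_y F y = \int[nu b]_y (F y * (rho b y)%:E))%E) ->
  forall t (F : trace R t.+1 t -> \bar R), (t <= T)%N ->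
  measurable_fun setT F -> (forall k, 0 <= F k)%E ->
  (\int[prob M']_w F (history M' t w) =
   \int[prob M]_w (F (history M t w) * (likelihood (history M t w))%:E))%E.
Proof.
move=> nurho; elim=> [|t IH] F tT mF F0.
  rewrite integral_history0// (_ : (\int[prob M]_w _) = (\int[prob M]_w F (history M 0 w)))%E.
    by rewrite integral_history0.
  by apply: eq_integral => w _; rewrite mule1.
have mFL : measurable_fun setT (fun h => F h * (likelihood h)%:E)%E.
  apply: emeasurable_funM => //; apply/measurable_EFinP; exact: measurable_likelihood.
have FL0 h : (0 <= F h * (likelihood h)%:E)%E by rewrite mule_ge0// lee_fin likelihood_ge0.
rewrite integral_history// (integral_history M tT mFL FL0) IH//; last 3 first.
- exact: ltnW.
- exact: measurable_one_round.
- by move=> k; do 2 apply: integral_ge0 => ? _.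
apply: eq_integral => w _; move: (history M t w) => {w} k.
rewrite /one_round.
have mnext G : measurable_fun setT G ->
   measurable_fun setT (fun z : mR * mR =>
     (G : trace R t.+2 t.+1 -> \bar R) (snoc k.1 z.2, snoc k.2 (z.1 * (decide pi k).2%:R))).
  move=> /measurable_next mG.
  apply: (measurableT_comp mG (g := fun z : mR * mR => (k, z.1, z.2))).
  by apply: measurable_fun_pair => //; exact: measurable_fun_pair.
pose Phi r := (\int[uniform_prob (@ltr01 R)]_u
   F (snoc k.1 u, snoc k.2 (r * (decide pi k).2%:R)%R))%E.
have mPhi : measurable_fun setT Phi.
  exact: (measurable_integral_section (uniform_prob (@ltr01 R)) (mnext _ mF) (fun=> F0 _)).
have Phi0 r : (0 <= Phi r)%E by apply: integral_ge0.
pose fac r := if (decide pi k).2 then rho (decide pi k).1 r else 1.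
transitivity (\int[nu (decide pi k).1]_r (Phi r * (fac r)%:E * (likelihood k)%:E))%E; last first.
  apply: eq_integral => r _.
  rewrite -muleA -EFinM -ge0_integralZr//.
  - apply: eq_integral => u _ /=; rewrite !front_snoc last_snoc -surjective_pairing.
    congr (_ * _%:E)%E; rewrite mulrC /fac.
    by case: (decide pi k).2; rewrite ?mulr1.
  - apply: (measurableT_comp mF (g := fun u => (snoc k.1 u, snoc k.2 (r * (decide pi k).2%:R)%R))).
    by apply: measurable_fun_pair => //; exact: measurable_snoc.
  - by rewrite lee_fin; apply: mulr_ge0; [rewrite /fac; case: ifP | exact: likelihood_ge0].
have mfac : measurable_fun setT (fac : mR -> mR).
  by rewrite /fac; case: (decide pi k).2; [exact: mrho | exact: measurable_cst].
have fac0 r : 0 <= fac r by rewrite /fac; case: ifP.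
rewrite [RHS]ge0_integralZr//; last 3 first.
- by apply: emeasurable_funM => //; exact/measurable_EFinP.
- by move=> r _; rewrite mule_ge0// lee_fin.
- by rewrite lee_fin; exact: likelihood_ge0.
congr (_ * _)%E.
suff : (\int[nu' (decide pi k).1]_r Phi r =
        \int[nu (decide pi k).1]_r (Phi r * (fac r)%:E))%E by [].
have [q|q] := boolP (decide pi k).2.
  by rewrite nurho//; apply: eq_integral => r _; rewrite /fac q.
(* In an unqueried round the observation is 0 whatever the reward, so both integrands are constant
   and the two reward laws give the same value. *)
transitivity (Phi 0); last symmetry.
  rewrite (eq_integral (cst (Phi 0))).
    by rewrite integral_cst// [X in (_ * X)%E]probability_setT mule1.
  by move=> r _; rewrite /Phi /fac (negbTE q) /= !mulr0.
rewrite (eq_integral (cst (Phi 0))).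
  by rewrite integral_cst// [X in (_ * X)%E]probability_setT mule1.
by move=> r _; rewrite /Phi /fac (negbTE q) /= !mulr0 mule1.
Qed.

End likelihood.
End change_of_measure.

Arguments likelihood {R A} pi rho {t} h.

(** * A Pinsker-type bound: from divergence to deviation of probabilities *)

Section integrals_on_probability_space.
Context d (W : measurableType d) (R : realType) (P : probability W R).

Lemma integral_sum_indic (I : eqType) (r : seq I) (c : I -> R) (E : I -> set W) :
  (forall i, measurable (E i)) ->
  (\int[P]_w (\sum_(i <- r) c i * \1_(E i) w)%:E =
   (\sum_(i <- r) c i * fine (P (E i)))%:E)%E.
Proof.
move=> mE; under eq_integral do rewrite -sumEFin.
have int1 i : P.-integrable setT (EFin \o \1_(E i) : W -> \bar R).
  by apply: integrable_indic.
rewrite integral_sum//; last first.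
  by move=> i; exact: (integrableZl measurableT (c i) (int1 i)).
rewrite -sumEFin; apply: eq_bigr => i _; under eq_integral do rewrite EFinM.
rewrite integralZl//; last exact: int1.
by rewrite integral_indic// setIT EFinM fineK//; exact: fin_num_measure.
Qed.

Lemma integrable_bounded (f : W -> R) (K : R) :
  measurable_fun setT f -> (forall w, `|f w| <= K) ->
  P.-integrable setT (EFin \o f).
Proof.
move=> mf fK; apply: measurable_bounded_integrable => //.
  by rewrite probability_setT ltry.
exists K; split; first exact: num_real.
by move=> x Kx w _; exact: le_trans (fK w) (ltW Kx).
Qed.

(* The product |s - 1| (s + 1), s = e^(x/2), is split by AM-GM with weight 12,
   and (s - 1)^2 <= s^2 - 1 - ln s^2. *)
Lemma normr_expR_sub1_le (x : R) :
  `|expR x - 1| <= 6 * (expR x - 1 - x) + (expR x + 1) / 12.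
Proof.
pose s := expR (x / 2); have s0 : 0 < s by exact: expR_gt0.
have -> : expR x = s * s by rewrite -expRD; congr expR; lra.
have : 1 + x / 2 <= s by exact: expR_ge1Dx.
(* With u = s - 1 and x <= 2 u, the two signs of the absolute value reduce to 61 u^2 - 22 u + 2 >= 0
   and 85 u^2 + 26 u + 2 >= 0, minimal at u = 11/61 and u = -13/85. *)
have := sqr_ge0 (s - 1 - 11 / 61); have := sqr_ge0 (s - 1 + 13 / 85).
by move=> ? ? sx; rewrite ler_norml; apply/andP; split; nra.
Qed.

(* A form of Pinsker's inequality: [expR g] is a density, and
   [- \int g] is the Kullback-Leibler divergence from P. *)
Lemma integral_normr_expR_sub1_le (g : W -> R) (K : R) :
  measurable_fun setT g -> (forall w, `|g w| <= K) ->
  \int[P]_w expR (g w) = 1 ->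
  \int[P]_w `|expR (g w) - 1| <= - 6 * \int[P]_w g w + 6^-1.
Proof.
move=> mg gK g1.
have mL : measurable_fun setT (fun w => expR (g w)) by exact: measurableT_comp.
have ig := integrable_bounded mg gK.
have LK w : `|expR (g w)| <= expR K.
  by rewrite ger0_norm ?expR_ge0// ler_expR (le_trans (ler_norm _)).
have iL := integrable_bounded mL LK.
have i1 : P.-integrable setT (EFin \o cst (1:R)).
  apply: (integrable_bounded (K := 1)) => // w; by rewrite normr1.
have idiff : P.-integrable setT (EFin \o (fun w => `|expR (g w) - 1|)).
  apply: (integrable_norm (f := fun w => expR (g w) - 1)).
  exact: (integrableB measurableT iL i1).
pose h w := (73 / 12) * expR (g w) + (- 6 * g w + (- (71 / 12)) * cst 1 w).
have imul (k : R) (f : W -> R) : P.-integrable setT (EFin \o f) ->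
    P.-integrable setT (EFin \o (fun w => k * f w)).
  by move=> fi; exact: (integrableZl measurableT k fi).
have iadd (f f' : W -> R) : P.-integrable setT (EFin \o f) ->
    P.-integrable setT (EFin \o f') ->
    P.-integrable setT (EFin \o (fun w => f w + f' w)).
  by move=> fi fi'; exact: (integrableD measurableT fi fi').
have -> : - 6 * \int[P]_w g w + 6^-1 = \int[P]_w h w.
  rewrite /h RintegralD//; [|by apply: imul|by apply: iadd; apply: imul].
  rewrite RintegralD//; [|by apply: imul|by apply: imul].
  rewrite !RintegralZl// g1 Rintegral_cst// [X in fine X]probability_setT /=.
  lra.
apply: le_Rintegral => //; first by apply: (iadd); [|apply: (iadd)]; apply: imul.
by move=> w _; have := normr_expR_sub1_le (g w); rewrite /h /=; lra.
Qed.

(** The difference is the integral over [S] of [expR g - 1], bounded by the total variation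
    integral. The value [p] is abstract because it will be a probability on another sample space. *)
Lemma event_deviation_le (g : W -> R) (K : R) (S : set W) (p : \bar R) :
  measurable_fun setT g -> (forall w, `|g w| <= K) ->
  \int[P]_w expR (g w) = 1 -> measurable S ->
  (p = \int[P]_w ((\1_S w)%:E * (expR (g w))%:E))%E ->
  `|fine p - fine (P S)| <= - 6 * \int[P]_w g w + 6^-1.
Proof.
move=> mg gK g1 mS ->.
apply: le_trans (integral_normr_expR_sub1_le mg gK g1).
have mL : measurable_fun setT (fun w => expR (g w)) by exact: measurableT_comp.
have LK w : `|expR (g w)| <= expR K.
  by rewrite ger0_norm ?expR_ge0// ler_expR (le_trans (ler_norm _)).
have mSL : measurable_fun setT (fun w => \1_S w * expR (g w)).
  by apply: measurable_funM => //; exact: measurable_indic.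
have S01 w : 0 <= (\1_S w : R) <= 1 by rewrite indicE; case: (w \in S) => //=; rewrite lexx ler01.
have iSL : P.-integrable setT (EFin \o (fun w => \1_S w * expR (g w))).
  apply: (integrable_bounded mSL (K := expR K)) => w; rewrite normrM.
  by rewrite -[leRHS]mul1r ler_pM// ger0_norm; case/andP: (S01 w).
have iS : P.-integrable setT (EFin \o \1_S : W -> \bar R) by exact: integrable_indic.
have -> : fine (P S) = \int[P]_w \1_S w.
  by rewrite /Rintegral integral_indic// setIT.
have -> : fine (\int[P]_w ((\1_S w)%:E * (expR (g w))%:E))%E = \int[P]_w (\1_S w * expR (g w)).
  by rewrite /Rintegral; congr fine; apply: eq_integral => w _; rewrite EFinM.
rewrite -RintegralB//.
have mB : measurable_fun setT (fun w => \1_S w * expR (g w) - \1_S w).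
  by apply: measurable_funB => //; exact: measurable_indic.
have iB : P.-integrable setT (EFin \o (fun w => \1_S w * expR (g w) - \1_S w)).
  exact: (integrableB measurableT iSL iS).
apply: le_trans (le_normr_Rintegral measurableT iB) _.
apply: le_Rintegral => //; first exact: integrable_norm.
  apply: (integrable_norm (f := fun w => expR (g w) - 1)).
  have i1 : P.-integrable setT (EFin \o cst (1:R)).
    by apply: (integrable_bounded (K := 1)) => // w; rewrite normr1.
  exact: (integrableB measurableT (integrable_bounded mL LK) i1).
move=> w _; rewrite indicE; case: (w \in S); rewrite ?mul1r// mul0r subr0 normr0.
exact: normr_ge0.
Qed.

End integrals_on_probability_space.

(** * Bernoulli bandits with one perturbed arm *)

Section bernoulli_bandit.
Context (R : realType).
Local Notation mR := (measurableTypeR R).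

Let measurable_toR : measurable_fun setT (fun b : bool => b%:R : mR).
Proof. by []. Qed.

Definition bernoulli01 (p : R) : probability mR R :=
  distribution (bernoulli_prob p) (mfun_of measurable_toR).

Lemma integral_bernoulli01 p (F : mR -> \bar R) : 0 <= p <= 1 ->
  measurable_fun setT F -> (forall y, 0 <= F y)%E ->
  (\int[bernoulli01 p]_y F y = p%:E * F 1%R + (1 - p)%:E * F 0%R)%E.
Proof.
move=> p01 mF F0; rewrite ge0_integral_distribution//.
by rewrite integral_bernoulli_prob//=.
Qed.

Lemma bernoulli01_itv p : bernoulli01 p `[0, 1]%classic = 1%E.
Proof.
rewrite /bernoulli01 /distribution /pushforward /=.
rewrite (_ : _ @^-1` _ = setT) ?probability_setT//.
by apply/seteqP; split => // -[] _ /=; rewrite in_itv/= ?lexx ?ler01.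
Qed.

Lemma mean_bernoulli01 p : 0 <= p <= 1 -> \int[bernoulli01 p]_y y = p.
Proof.
move=> p01; rewrite /Rintegral integral_distribution//; last first.
  apply: (integrable_bounded (bernoulli_prob p) (f := fun b : bool => b%:R : R) (K := 1)) => //.
  by case; rewrite ?normr1 ?normr0.
rewrite integral_bernoulli_prob//; last by case; rewrite lee_fin.
by rewrite /= mulr1 mulr0 addr0.
Qed.

Context (A : nat).

Definition bernoulli_bandit (theta : 'I_A -> R) : bandit_instance R A :=
  BanditInstance (fun a => bernoulli01_itv (theta a)).

Lemma mean_bernoulli_bandit theta a : 0 <= theta a <= 1 ->
  mean (bernoulli_bandit theta) a = theta a.
Proof. exact: mean_bernoulli01. Qed.

Definition fair : bandit_instance R A := bernoulli_bandit (fun=> 2^-1).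

(** The sign of [x] is free, so that raising and lowering arm [a] are treated together. *)
Definition tilted (a : 'I_A) (x : R) : bandit_instance R A :=
  bernoulli_bandit (fun b => 2^-1 + (if b == a then x else 0)).

(** The density of Bernoulli(1/2 + x) with respect to Bernoulli(1/2) on arm [a]. Every y other than
    1 is treated like the outcome 0, which makes it total and measurable. *)
Definition tilt_density (a : 'I_A) (x : R) (b : 'I_A) (y : R) : R :=
  if b == a then (if y == 1 then 1 + 2 * x else 1 - 2 * x) else 1.

Lemma measurable_tilt_density a x b : measurable_fun setT (tilt_density a x b : mR -> mR).
Proof.
rewrite /tilt_density; case: (b == a) => //.
by apply: measurable_fun_ifT => //; exact: measurable_fun_eqr.
Qed.

Lemma tilt_density_ge0 a x b y : `|x| <= 10^-1 -> 0 <= tilt_density a x b y.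
Proof. by rewrite /tilt_density ler_norml => /andP[? ?]; do 2 case: ifP => _ //; lra. Qed.

Lemma integral_tilted a x b (F : mR -> \bar R) : `|x| <= 10^-1 ->
  measurable_fun setT F -> (forall y, 0 <= F y)%E ->
  (\int[tilted a x b]_y F y = \int[fair b]_y (F y * (tilt_density a x b y)%:E))%E.
Proof.
move=> x10 mF F0; have := x10; rewrite ler_norml => /andP[x1 x2].
rewrite !integral_bernoulli01//; last 4 first.
- lra.
- apply: emeasurable_funM => //; apply/measurable_EFinP; exact: measurable_tilt_density.
- by move=> y; rewrite mule_ge0// lee_fin tilt_density_ge0.
- by case: ifP => _; lra.
rewrite /tilt_density eqxx [0 == 1]eq_sym oner_eq0; case: ifP => _.
  by rewrite ![(F _ * _)%E]muleC !muleA -!EFinM; congr (_%:E * _ + _%:E * _)%E; field.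
by rewrite !mule1 addr0.
Qed.

End bernoulli_bandit.

(** * Divergence of the histories and deviation of the pull probabilities *)

Section deviation.
Context (R : realType) (A T : nat) (pi : strategy R A).

Definition pulls (nu : bandit_instance R A) (M : interaction T pi nu) a t : set (sample_space M) :=
  [set w | arm M t w = a].

Definition queries (nu : bandit_instance R A) (M : interaction T pi nu) a t : set (sample_space M) :=
  [set w | arm M t w = a /\ query M t w].

Arguments pulls {nu} M a t.
Arguments queries {nu} M a t.

Definition expected_queries (nu : bandit_instance R A) (M : interaction T pi nu) a : R :=
  \sum_(t < T) fine (prob M (queries M a t.+1)).

Lemma measurable_pulls (nu : bandit_instance R A) (M : interaction T pi nu) a t :
  (t < T)%N -> measurable (pulls M a t.+1).
Proof. by move=> tT; exact (measurable_arm_preimage (measurable_arm (M := M) tT) a). Qed.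

Lemma measurable_queries (nu : bandit_instance R A) (M : interaction T pi nu) a t :
  (t < T)%N -> measurable (queries M a t.+1).
Proof.
move=> tT; apply: measurableI; first exact: measurable_pulls.
rewrite -[X in measurable X]setTI.
exact: (measurable_query (M := M) tT measurableT (Y := [set true])).
Qed.

Variables (M : interaction T pi (fair R A)).

Definition outcome a (t : nat) (b : bool) : set (sample_space M) :=
  queries M a t `&` [set w | (reward M t w == 1) = b].

Lemma measurable_outcome a t b : (t < T)%N -> measurable (outcome a t.+1 b).
Proof.
move=> tT; apply: measurableI; first exact: measurable_queries.
rewrite -[X in measurable X]setTI.
have m1 : measurable_fun setT (fun w => reward M t.+1 w == 1).
  have mr : measurable_fun setT (reward M t.+1) by exact: measurable_funP.
  have m1 : measurable_fun setT (fun y : measurableTypeR R => y == 1) by exact: measurable_fun_eqr.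
  exact: (measurableT_comp m1 mr).
exact: (m1 measurableT [set b]).
Qed.

(** Whether [a] is queried in round t + 1 is decided by I_t, and given I_t a fair reward takes each
    value with probability 1/2. *)
Lemma prob_outcome a t b : (t < T)%N ->
  fine (prob M (outcome a t.+1 b)) = 2^-1 * fine (prob M (queries M a t.+1)).
Proof.
move=> tT.
pose C := [set k : trace R t.+1 t | (decide pi k).1 = a /\ (decide pi k).2].
have mC : measurable C.
  apply: measurableI; first exact: measurable_arm_preimage (measurable_decide_arm pi (t := t)) a.
  rewrite -[X in measurable X]setTI.
  exact: (measurable_decide_query pi measurableT (Y := [set true])).
pose D : set (measurableTypeR R) := [set y | (y == 1) = b].
have mD : measurable D.
  rewrite -[X in measurable X]setTI.
  have m1 : measurable_fun setT (fun y : measurableTypeR R => y == 1) by exact: measurable_fun_eqr.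
  exact: (m1 measurableT [set b]).
have QC w : C (history M t w) = queries M a t.+1 w.
  by rewrite /C /queries /= armE// queryE.
have CQ w : (history M t w \in C) = (w \in queries M a t.+1).
  by apply/idP/idP; rewrite !inE QC.
have mQ := measurable_queries M a tT.
have mO := measurable_outcome a b tT.
pose F (z : trace R t.+1 t * measurableTypeR R) : \bar R := (\1_C z.1 * \1_D z.2)%:E.
have mF : measurable_fun setT F.
  apply/measurable_EFinP; apply: measurable_funM.
    exact: (measurableT_comp (measurable_indic mC) measurable_fst).
  exact: (measurableT_comp (measurable_indic mD) measurable_snd).
have F0 z : (0 <= F z)%E by rewrite lee_fin mulr_ge0.
have := integral_reward M tT mF F0.
have -> : (\int[prob M]_w F (history M t w, reward M t.+1 w) = prob M (outcome a t.+1 b))%E.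
  rewrite -[outcome a t.+1 b]setIT -integral_indic//; apply: eq_integral => w _.
  by rewrite /F /= !indicE /outcome in_setI -CQ -natrM mulnb.
move=> ->.
have -> : (\int[prob M]_w \int[fair R A (arm M t.+1 w)]_r F (history M t w, r) =
    \int[prob M]_w (2^-1%:E * (\1_(queries M a t.+1) w)%:E))%E.
  apply: eq_integral => w _; rewrite integral_bernoulli01//=; last 2 first.
  - lra.
  - exact: (measurableT_comp mF).
  have D1 : (1 \in D) = b by apply/idP/idP; rewrite inE /D /= eqxx; [move=> <-|move=> ->].
  have D0 : (0 \in D) = ~~ b.
    apply/idP/idP; rewrite inE /D /= [0 == 1]eq_sym oner_eq0; first by move=> <-.
    by case: (b).
  rewrite /F /= !indicE D1 D0 CQ; case: b {D D1 D0 mD F mF F0 mO} => /=;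
    rewrite ?mulr1 ?mulr0 -?EFinM -?EFinD; congr _%:E; lra.
rewrite ge0_integralZl//; last first.
  by apply/measurable_EFinP; exact: measurable_indic.
by rewrite integral_indic// setIT fineM//; exact: fin_num_measure.
Qed.

(** Written as a finite combination of indicators, so that it is visibly bounded and its integral is
    a sum of outcome probabilities. *)
Definition log_likelihood a (x : R) t (w : sample_space M) : R :=
  \sum_(p : 'I_t * bool)
    ln (if p.2 then 1 + 2 * x else 1 - 2 * x) * \1_(outcome a p.1.+1 p.2) w.

Lemma expR_log_likelihood a (x : R) t w : `|x| <= 10^-1 -> (t <= T)%N ->
  expR (log_likelihood a x t w) = likelihood pi (tilt_density a x) (history M t w).
Proof.
rewrite ler_norml => /andP[x1 x2] tT.
rewrite /log_likelihood -(pair_bigA _ (fun (i : 'I_t) (b : bool) =>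
   ln (if b then 1 + 2 * x else 1 - 2 * x) * \1_(outcome a i.+1 b) w)) /=.
rewrite expR_sum likelihood_history// big_mkord; apply: eq_bigr => s _.
have sT : (s < T)%N by apply: leq_trans tT.
rewrite big_bool /=.
have oE b : \1_(outcome a s.+1 b) w =
    [&& arm M s.+1 w == a, query M s.+1 w & (reward M s.+1 w == 1) == b]%:R :> R.
  rewrite indicE; congr (_ : bool)%:R; apply/idP/and3P; rewrite inE.
    by case=> -[/= -> ->] ->.
  by case=> /eqP ? ? /eqP.
rewrite !oE /tilt_density; have [_|_] := boolP (arm M s.+1 w == a); last first.
  by rewrite !andFb !mulr0n !mulr0 addr0 expR0; case: ifP.
rewrite !andTb /observation; have [_|_] := boolP (query M s.+1 w); last first.
  by rewrite !andFb !mulr0n !mulr0 addr0 expR0.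
rewrite !andTb mulr1n mulr1; have [_|_] := boolP (reward M s.+1 w == 1).
  by rewrite mulr1n mulr0n mulr1 mulr0 addr0 lnK// posrE; lra.
by rewrite mulr1n mulr0n mulr1 mulr0 add0r lnK// posrE; lra.
Qed.

Lemma measurable_log_likelihood a x t : (t <= T)%N ->
  measurable_fun setT (log_likelihood a x t).
Proof.
move=> tT; apply: measurable_sum => p; apply: measurable_funM => //.
apply: measurable_indic; apply: measurable_outcome; exact: leq_trans tT.
Qed.

Lemma log_likelihood_bounded a x t w : `|log_likelihood a x t w| <=
  \sum_(p : 'I_t * bool) `|ln (if p.2 then 1 + 2 * x else 1 - 2 * x)|.
Proof.
apply: le_trans (ler_norm_sum _ _ _) _; apply: ler_sum => p _.
by rewrite normrM ler_piMr// indicE; case: (_ \in _); rewrite ?normr1 ?normr0.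
Qed.

(** The left-hand side is the divergence of the histories. Each round contributes - ln(1 - 4 x^2) /
    2 times the probability that [a] is queried in it. *)
Lemma integral_log_likelihood a (x : R) t : `|x| <= 10^-1 -> (t <= T)%N ->
  - (\int[prob M]_w log_likelihood a x t w) <= 25 / 12 * (x ^+ 2 * expected_queries M a).
Proof.
move=> x10 tT; have := x10; rewrite ler_norml => /andP[x1 x2].
rewrite /Rintegral /log_likelihood integral_sum_indic/=; last first.
  by move=> p; apply: measurable_outcome; exact: leq_trans tT.
rewrite -(pair_bigA _ (fun (i : 'I_t) (b : bool) =>
   ln (if b then 1 + 2 * x else 1 - 2 * x) * fine (prob M (outcome a i.+1 b)))) /=.
pose q s := fine (prob M (queries M a s.+1)).
have q0 s : 0 <= q s by exact: fine_ge0.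
(* With y = 1 - 4 x^2 >= 24/25, - ln y <= 1/y - 1 = 4 x^2 / y <= (25/6) x^2. *)
have lnE : - (ln (1 + 2 * x) + ln (1 - 2 * x)) <= 25 / 6 * x ^+ 2.
  rewrite -lnM ?posrE; try lra.
  set y := _ * _; have yE : y = 1 - 4 * x ^+ 2 by rewrite /y; ring.
  have xx : x ^+ 2 <= 100^-1 by nra.
  have y0 : 0 < y by rewrite yE; lra.
  rewrite -lnV ?posrE//.
  have := @le_ln1Dx R (y^-1 - 1).
  rewrite addrCA subrr addr0.
  have yV : y^-1 - 1 <= 25 / 6 * x ^+ 2.
    by rewrite lerBlDr -div1r ler_pdivrMr// yE; nra.
  move=> h; apply: le_trans yV; apply: h.
  by rewrite ltrBrDl subrr invr_gt0.
rewrite (eq_bigr (fun s : 'I_t => 2^-1 * (ln (1 + 2 * x) + ln (1 - 2 * x)) * q s)); last first.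
  move=> s _; rewrite big_bool /= !prob_outcome ?(leq_trans _ tT)// -/(q s); ring.
rewrite -mulr_sumr.
have : \sum_(s < t) q s <= expected_queries M a.
  rewrite /expected_queries -!(big_mkord xpredT q) (big_cat_nat _ tT)//= lerDl.
  exact: sumr_ge0.
have : 0 <= \sum_(s < t) q s by exact: sumr_ge0.
set Q := \sum_(_ < _) _; set L := ln _ + ln _ in lnE *.
move=> Q0 QN; have x20 := sqr_ge0 x.
have : - L * Q <= 25 / 6 * x ^+ 2 * Q by exact: ler_wpM2r.
have : x ^+ 2 * Q <= x ^+ 2 * expected_queries M a by exact: ler_wpM2l.
nra.
Qed.

Lemma pull_deviation a (x : R) (M' : interaction T pi (tilted a x)) t :
  `|x| <= 10^-1 -> x ^+ 2 * expected_queries M a <= 100^-1 -> (t < T)%N ->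
  `|fine (prob M' (pulls M' a t.+1)) - fine (prob M (pulls M a t.+1))| <= 3^-1.
Proof.
move=> x10 xN tT; have tT' := ltnW tT.
have change := change_of_measure (measurable_tilt_density a x)
  (fun b y => tilt_density_ge0 a b y x10) M M'
  (fun b F => integral_tilted a b x10).
(* Total mass: the change of measure applied to the constant function 1. *)
have g1 : \int[prob M]_w expR (log_likelihood a x t w) = 1.
  have := change t (cst 1%E) tT' (measurable_cst _) (fun=> lee01).
  rewrite integral_cst// [X in (_ * X)%E]probability_setT mule1 => e.
  rewrite /Rintegral -[RHS]/(fine 1%E) e; congr fine; apply: eq_integral => w _.
  by rewrite expR_log_likelihood// mul1e.
have mS := measurable_pulls M a tT.
have := event_deviation_le (measurable_log_likelihood a x tT')
  (log_likelihood_bounded a x t) g1 mS.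
move=> /(_ (prob M' (pulls M' a t.+1))) h.
have := integral_log_likelihood a x10 tT'.
(* The constants add up to 6 * (25/12) / 100 + 1/6 = 7/24 <= 1/3. The identity left to prove is the
   change of measure for the arm of round t + 1, a function of I_t. *)
suff /h : (prob M' (pulls M' a t.+1) = \int[prob M]_w
   ((\1_(pulls M a t.+1) w)%:E * (expR (log_likelihood a x t w))%:E))%E by lra.
pose C := [set k : trace R t.+1 t | (decide pi k).1 = a].
have mC : measurable C.
  exact: measurable_arm_preimage (measurable_decide_arm pi (t := t)) a.
have mF : measurable_fun setT (fun k => (\1_C k)%:E : \bar R).
  by apply/measurable_EFinP; exact: measurable_indic.
have CE nu (N : interaction T pi nu) w : \1_C (history N t w) = \1_(pulls N a t.+1) w :> R.
  by rewrite !indicE; congr (_ : bool)%:R; apply/idP/idP; rewrite !inE /C /pulls /= armE.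
rewrite -[X in prob M' X]setIT -integral_indic//; last exact: measurable_pulls.
transitivity (\int[prob M']_w (\1_C (history M' t w))%:E)%E.
  by apply: eq_integral => w _; rewrite CE.
have C0 k : (0 <= (\1_C k)%:E :> \bar R)%E by rewrite lee_fin.
rewrite (change t _ tT' mF C0).
by apply: eq_integral => w _; rewrite CE expR_log_likelihood.
Qed.

End deviation.

Arguments pulls {R A T pi nu} M a t.
Arguments queries {R A T pi nu} M a t.

(** Averaging with weights c(a) / S, where S is the total cost: if S N_a > B for all a, the weighted
    sum of the N_a would exceed B, strictly because some cost is positive. *)
Lemma exists_rarely_queried_arm (R : realType) (A : nat) (c N : 'I_A -> R) (B : R) : (forall a, 0 <= c a) ->
  0 < \sum_a c a -> \sum_a c a * N a <= B ->
  exists a, (\sum_a c a) * N a <= B.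
Proof.
move=> c0 S0 cN; apply: contrapT => /forallNP NB.
have lt_N a : B < (\sum_a c a) * N a by rewrite ltNge; apply/negP; exact: NB.
have [a _ ca] : exists2 a, true & 0 < c a.
  apply/exists2P; apply: contrapT => /forallNP h.
  move: S0; rewrite big1 ?ltxx// => a _; apply/eqP; rewrite eq_le c0 andbT leNgt.
  by apply/negP => ca; apply: (h a).
suff : (\sum_a c a) * B < (\sum_a c a) * B by rewrite ltxx.
apply: (@lt_le_trans _ _ ((\sum_a c a) * (\sum_a c a * N a))); last by rewrite ler_wpM2l// ltW.
rewrite {1}mulr_suml; move: lt_N S0; set S := \sum_a c a => lt_N S0.
rewrite mulr_sumr (bigD1 a)//= [ltRHS](bigD1 a)//=; apply: ltr_leD.
  by rewrite mulrCA ltr_pM2l.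
by apply: ler_sum => b _; rewrite mulrCA ler_wpM2l// ltW.
Qed.

(** * Expected cost and regret, and the two-point argument *)

Section regret_lower_bound.
Context (R : realType) (A T : nat) (pi : strategy R A).

Lemma expectation_query_cost (c : 'I_A -> R) (nu : bandit_instance R A) (M : interaction T pi nu) :
  ('E_(prob M)[query_cost c M] = (\sum_a c a * expected_queries M a)%:E)%E.
Proof.
rewrite unlock /query_cost.
transitivity (\int[prob M]_w (\sum_(p : 'I_T * 'I_A) c p.2 * \1_(queries M p.2 p.1.+1) w)%:E)%E.
  apply: eq_integral => w _; congr _%:E.
  rewrite big_add1 /= big_mkord -(pair_bigA _ (fun (t : 'I_T) b => c b * \1_(queries M b t.+1) w)) /=.
  apply: eq_bigr => t _; rewrite (bigD1 (arm M t.+1 w))//= big1 ?addr0.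
    congr (_ * _); rewrite indicE; congr (_ : bool)%:R; apply/idP/idP; rewrite inE /queries /=; tauto.
  by move=> b /negP ba; rewrite indicE memNset ?mulr0// => -[/= e _]; apply: ba; rewrite e.
rewrite integral_sum_indic; last by move=> p; exact: measurable_queries.
congr _%:E.
rewrite -(pair_bigA _ (fun (t : 'I_T) b => c b * fine (prob M (queries M b t.+1)))) /=.
by rewrite exchange_big /=; apply: eq_bigr => b _; rewrite mulr_sumr.
Qed.

(** The gaps of both perturbed bandits have this form: (u, v) = (x, - x) when [a] is raised and (0,
    x) when it is lowered. *)
Lemma expectation_regret (nu : bandit_instance R A) (M : interaction T pi nu) a (u v : R) :
  (forall b, best_mean nu - mean nu b = u + (if b == a then v else 0)) ->
  ('E_(prob M)[regret M] = (\sum_(t < T) (u + v * fine (prob M (pulls M a t.+1))))%:E)%E.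
Proof.
move=> gap; rewrite unlock /regret.
(* The boolean separates the constant part [u], carried by the whole space, from the part [v]
   carried by the pulls of [a]. *)
transitivity (\int[prob M]_w (\sum_(p : 'I_T * bool) (if p.2 then u else v) *
    \1_(if p.2 then setT else pulls M a p.1.+1) w)%:E)%E.
  apply: eq_integral => w _; congr _%:E.
  rewrite big_add1 /= big_mkord -(pair_bigA _ (fun (t : 'I_T) (b : bool) =>
    (if b then u else v) * \1_(if b then setT else pulls M a t.+1) w)) /=.
  apply: eq_bigr => t _; rewrite big_bool /= gap; congr (_ + _).
    by rewrite indicE in_setT mulr1.
  rewrite indicE; have [e|e] := eqVneq (arm M t.+1 w) a.
    by rewrite mem_set// mulr1.
  by rewrite memNset ?mulr0// => /eqP; apply/negP.
rewrite integral_sum_indic; last by move=> [t []] //=; exact: measurable_pulls.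
congr _%:E.
rewrite -(pair_bigA _ (fun (t : 'I_T) (b : bool) =>
    (if b then u else v) * fine (prob M (if b then setT else pulls M a t.+1)))) /=.
apply: eq_bigr => t _; rewrite big_bool /=.
by rewrite [prob M setT]probability_setT /= mulr1.
Qed.

Lemma mean_tilted (a : 'I_A) (x : R) b : `|x| <= 10^-1 ->
  mean (tilted a x) b = 2^-1 + (if b == a then x else 0).
Proof.
rewrite ler_norml => /andP[? ?].
by rewrite mean_bernoulli_bandit//; case: ifP => _; lra.
Qed.

Lemma best_mean_tilted (a : 'I_A) (x : R) : 0 <= x <= 10^-1 ->
  best_mean (tilted a x) = 2^-1 + x.
Proof.
move=> /andP[x0 x1]; have x10 : `|x| <= 10^-1 by rewrite ger0_norm.
apply/le_anti/andP; split.
  apply/bigmax_leP; split; first lra.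
  by move=> b _; rewrite mean_tilted//; case: ifP => _; lra.
by apply: (bigmax_sup a) => //; rewrite mean_tilted// eqxx.
Qed.

(** Since A >= 2, another arm keeps mean 1/2 when [a] is lowered. *)
Lemma best_mean_tiltedN (a : 'I_A) (x : R) : (2 <= A)%N -> 0 <= x <= 10^-1 ->
  best_mean (tilted a (- x)) = 2^-1.
Proof.
move=> A2 /andP[x0 x1]; have x10 : `|- x| <= 10^-1 by rewrite normrN ger0_norm.
have [b ba] : exists b : 'I_A, b != a.
  case: a => -[|i] iA; first by exists (Ordinal A2).
  by exists (Ordinal (ltn_trans (ltnSn 0) A2)).
apply/le_anti/andP; split.
  apply/bigmax_leP; split; first lra.
  by move=> i _; rewrite mean_tilted//; case: ifP => _; lra.
by apply: (bigmax_sup b) => //; rewrite mean_tilted// (negbTE ba) addr0.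
Qed.

Lemma exists_regret_ge (M : forall nu : bandit_instance R A, interaction T pi nu) a (x : R) :
  (2 <= A)%N -> 0 <= x <= 10^-1 ->
  x ^+ 2 * expected_queries (M (fair R A)) a <= 100^-1 ->
  exists nu : bandit_instance R A, ((T%:R * x / 6)%:E <= 'E_(prob (M nu))[regret (M nu)])%E.
Proof.
move=> A2 /[dup] x01 /andP[x0 x1] xN.
have x10 : `|x| <= 10^-1 by rewrite ger0_norm.
pose M0 := M (fair R A).
pose p t := fine (prob M0 (pulls M0 a t.+1)).
have sumE (k : R) : \sum_(t < T) k = T%:R * k by rewrite sumr_const card_ord mulr_natl.
(* If [a] is raised, it is played in at most 1/2 + 1/3 of the rounds on average; if it is lowered,
   in at least 1/2 - 1/3 of them. Either way a fraction 1/6 of the rounds costs x. *)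
have [pT|pT] := leP (\sum_(t < T) p t) (T%:R / 2).
- exists (tilted a x); rewrite (@expectation_regret _ _ a x (- x)); last first.
    by move=> b; rewrite best_mean_tilted// mean_tilted//; case: ifP => _; lra.
  rewrite lee_fin.
  apply: (@le_trans _ _ (\sum_(t < T) x * (2 / 3 - p t))); last first.
    apply: ler_sum => t _.
    have := pull_deviation (M (tilted a x)) x10 xN (ltn_ord t).
    rewrite -/M0 -/(p t) ler_norml => /andP[_ ?]; nra.
  rewrite -mulr_sumr sumrB sumE; nra.
- have xN10 : `|- x| <= 10^-1 by rewrite normrN.
  have xNN : (- x) ^+ 2 * expected_queries M0 a <= 100^-1 by rewrite sqrrN.
  exists (tilted a (- x)); rewrite (@expectation_regret _ _ a 0 x); last first.
    by move=> b; rewrite best_mean_tiltedN// mean_tilted//; case: ifP => _; lra.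
  rewrite lee_fin.
  apply: (@le_trans _ _ (\sum_(t < T) x * (p t - 3^-1))); last first.
    apply: ler_sum => t _.
    have := pull_deviation (M (tilted a (- x))) xN10 xNN (ltn_ord t).
    rewrite -/M0 -/(p t) ler_norml => /andP[? _]; nra.
  rewrite -mulr_sumr sumrB sumE; nra.
Qed.

End regret_lower_bound.

(** * Choice of the arm and of the size of the perturbation *)

Theorem proposition2 (R : realType) (T A : nat) (c : 'I_A -> R) (B : R)
    (pi : strategy R A)
    (M : forall nu : bandit_instance R A, interaction T pi nu) :
  (2 <= A)%N ->
  (forall a, 0 <= c a) ->
  0 <= B ->
  (forall nu : bandit_instance R A,
     ('E_(prob (M nu))[query_cost c (M nu)] <= B%:E)%E) ->
  exists nu : bandit_instance R A,
    ((140^-1)%:E *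
       Order.min (T%:R%:E * sqrte ((\sum_a c a)%:E / (B * (1 + ln A%:R))%:E))
                 T%:R%:E
     <= 'E_(prob (M nu))[regret (M nu)])%E.
Proof.
move=> A2 c0 B0 costB.
set S := \sum_a c a.
set N := expected_queries (M (fair R A)).
have A0 : 0 <= ln (A%:R : R) by apply: ln_ge0; rewrite ler1n; exact: ltnW.
have N0 a : 0 <= N a by apply: sumr_ge0 => t _; exact: fine_ge0.
have cN : \sum_a c a * N a <= B.
  by rewrite -lee_fin -expectation_query_cost; exact: costB.
(* With x = m / 10 the two-point argument gives regret T m / 60, which is at least T m / 140. *)
suff [m [a [m0 m1 mN minm]]] : exists (m : R) (a : 'I_A), [/\ 0 <= m, m <= 1,
    m ^+ 2 * N a <= 1 & (Order.min (T%:R%:E * sqrte (S%:E / (B * (1 + ln A%:R))%:E)) T%:R%:E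
      <= (T%:R * m)%:E)%E].
  have [||nu nuE] := @exists_regret_ge R A T pi M a (m / 10) A2.
  - by lra.
  - by rewrite -/N; nra.
  exists nu; apply: le_trans nuE.
  apply: (@le_trans _ _ ((140^-1)%:E * (T%:R * m)%:E)%E).
    by rewrite lee_wpmul2l// lee_fin.
  rewrite -EFinM lee_fin; have T0 : 0 <= T%:R :> R by [].
  have := mulr_ge0 T0 m0; lra.
(* If all costs vanish, the quotient is 0 even when B = 0, so the bound is 0 and m = 0 works. *)
have [S0|S0] := leP S 0.
  have -> : S = 0 by apply/le_anti; rewrite S0 sumr_ge0.
  exists 0, (Ordinal (ltn_trans (ltnSn 0) A2)); split => //.
  - by rewrite expr0n mul0r.
  - by rewrite mul0e sqrte0 mule0 mulr0 ge_min lexx.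
have [a aN] := exists_rarely_queried_arm c0 S0 cN.
(* If B = 0, then S N_a <= 0 forces N_a <= 0, and m = 1 is allowed; the minimum is at most T
   although the square root is infinite. *)
have [B00|Bpos] := eqVneq B 0.
  exists 1, a; split => //.
    by rewrite expr1n mul1r; move: aN; rewrite B00 pmulr_rle0// => /le_trans; apply.
  by rewrite mulr1 ge_min lexx orbT.
have {}Bpos : 0 < B by rewrite lt_neqAle eq_sym Bpos.
have BA : 0 < B * (1 + ln A%:R) by rewrite mulr_gt0//; lra.
exists (Num.min (Num.sqrt (S / B)) 1), a; split.
- by rewrite le_min sqrtr_ge0 ler01.
- by rewrite ge_min lexx orbT.
- apply: (@le_trans _ _ (S / B * N a)).
    apply: ler_wpM2r => //; rewrite -[leRHS]sqr_sqrtr; last by rewrite divr_ge0// ltW.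
    rewrite ler_pXn2r// ?nnegrE ?sqrtr_ge0// ?le_min ?sqrtr_ge0 ?ler01//.
    by rewrite ge_min lexx.
  by rewrite mulrAC ler_pdivrMr// mul1r.
- have -> : (S%:E / (B * (1 + ln A%:R))%:E = (S / (B * (1 + ln A%:R)))%:E)%E.
    by rewrite inver gt_eqF.
  rewrite /sqrte -EFinM -EFin_min lee_fin.
  have T0 : 0 <= T%:R :> R by [].
  rewrite minr_pMr// mulr1 le_min ge_min; apply/andP; split.
    (* As ln A >= 0, the denominator B (1 + ln A) is at least B. *)
    rewrite ler_wpM2l// ler_wsqrtr// ler_pM2l// lef_pV2 ?posrE//.
    by rewrite ler_peMr//; lra.
  by rewrite ge_min lexx orbT.
Qed.
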